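(* The Blum-Mansour swap regret algorithm is not monotone. That is, there exist a number of actions $k$, a horizon $T$, a learning rate $\eta>0$, two sequences of loss vectors $l_1,\tilde l_1,\dots,l_T,\tilde l_T\in\mathbb R^k$ that are identical except that $\tilde l_{s}[a]<l_{s}[a]$ for a single action $a$ in a single round $s$, and a later round $t>s$, such that the algorithm selects $a$ in round $t$ with strictly smaller probability under $(\tilde l_\tau)$ than under $(l_\tau)$.
   Context: Full-information online learning: in each round the algorithm outputs a distribution over $k$ actions and then observes a loss vector $l_t\in\mathbb R^k$. An algorithm is monotone if, for any two loss sequences that are identical except that the loss of one action $a$ in one round is decreased, the probability of selecting $a$ in every later round is at least as large under the sequence with the decreased loss. Exponential Weights with rate $\eta$: weights $w_j^1=1$; in round $t$ output the distribution $w^t_j/\sum_{j'}w^t_{j'}$; on receiving a loss vector $l^t$ set $w_j^{t+1}=w_j^t\exp(-\eta l_j^t)$. Blum-Mansour algorithm with rate $\eta$: maintain $k$ copies of Exponential Weights with rate $\eta$; let $q_i^t$ be the distribution output by copy $i$ in round $t$. In round $t$ play the distribution $p_t$ over actions that is stationary for the stochastic matrix with rows $q_1^t,\dots,q_k^t$, i.e. $p_t(j)=\sum_i p_t(i)q_i^t(j)$ for all $j$ (unique since all entries are positive). After observing the loss vector $l_t$, report the loss vector $p_t(i)\cdot l_t$ to copy $i$, for each $i$. *)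

(* Defs.v *)
From HB Require Import structures.
From mathcomp Require Import all_boot all_order all_algebra.
From mathcomp Require Import boolp classical_sets reals sequences exp.

Set Implicit Arguments.
Unset Strict Implicit.
Unset Printing Implicit Defensive.

Import Order.TTheory GRing.Theory Num.Theory.

Local Open Scope ring_scope.

(* A full-information algorithm is a map from the history of the loss vectors
   observed so far, oldest first, to the row vector played in the next round;
   on a sequence [l] it plays [A (take t l)] in round [t], counted from 0. *)
Definition algorithm (R : realType) (k : nat) : Type :=
  seq 'rV[R]_k -> 'rV[R]_k.

Definition ew_weights (R : realType) (k : nat) (eta : R)
    (h : seq 'rV[R]_k) : 'rV[R]_k :=
  foldl (fun w l : 'rV[R]_k => \row_j (w 0 j * expR (- eta * l 0 j))) (const_mx 1) h.

Definition exp_weights (R : realType) (k : nat) (eta : R) : algorithm R k :=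
  fun h =>
    let w := ew_weights eta h in \row_j (w 0 j / \sum_j' w 0 j').

Definition is_distribution (R : realType) (k : nat) (p : 'rV[R]_k) : Prop :=
  (forall j, 0 <= p 0 j) /\ \sum_j p 0 j = 1.

Definition is_stationary (R : realType) (k : nat) (Q : 'M[R]_k)
    (p : 'rV[R]_k) : Prop :=
  is_distribution p /\ forall j, p 0 j = \sum_i p 0 i * Q i j.

(* The default value 0 is never taken on the matrices used below: see
   [blum_mansour_stationary] and [stationary_unique]. *)
Definition stationary (R : realType) (k : nat) (Q : 'M[R]_k) : 'rV[R]_k :=
  xget 0 [set p | is_stationary Q p]%classic.

(* [H i] is the history of losses reported to copy [i]. *)
Definition bm_matrix (R : realType) (k : nat) (eta : R)
    (H : 'I_k -> seq 'rV[R]_k) : 'M[R]_k :=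
  \matrix_(i, j) exp_weights eta (H i) 0 j.

Definition bm_reports (R : realType) (k : nat) (eta : R)
    (h : seq 'rV[R]_k) : 'I_k -> seq 'rV[R]_k :=
  foldl (fun H l => let p := stationary (bm_matrix eta H) in
                    fun i => rcons (H i) (p 0 i *: l))
        (fun=> [::]) h.

Definition blum_mansour (R : realType) (k : nat) (eta : R) : algorithm R k :=
  fun h => stationary (bm_matrix eta (bm_reports eta h)).

Definition decreased_at (R : realType) (k T : nat) (s : 'I_T) (a : 'I_k)
    (l l' : T.-tuple 'rV[R]_k) : Prop :=
  tnth l' s 0 a < tnth l s 0 a /\
  forall (r : 'I_T) (b : 'I_k), (r, b) != (s, a) -> tnth l' r 0 b = tnth l r 0 b.

Definition monotone (R : realType) (k : nat) (A : algorithm R k) : Prop :=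
  forall (T : nat) (l l' : T.-tuple 'rV[R]_k) (s : 'I_T) (a : 'I_k),
    decreased_at s a l l' ->
    forall t : 'I_T, (s < t)%N -> A (take t l) 0 a <= A (take t l') 0 a.

Section Stationary.
Variables (R : realType) (k : nat) (Q : 'M[R]_k).
Hypothesis Q_gt0 : forall i j, 0 < Q i j.
Hypothesis Q_sum1 : forall i, \sum_j Q i j = 1.

Let fixed (f : 'I_k -> R) := forall j, f j = \sum_i f i * Q i j.

Let norm_sum0 (f : 'I_k -> R) : \sum_j `|f j| = 0 -> forall j, f j = 0.
Proof.
move=> S0 j; apply/eqP; rewrite -normr_eq0; apply/eqP.
exact: (psumr_eq0P (fun i _ => normr_ge0 (f i)) S0).
Qed.

Let fixed_norm f : fixed f -> fixed (fun j => `|f j|).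
Proof.
move=> ff j; apply/eqP; rewrite eq_sym -subr_eq0; apply/eqP.
pose d j := \sum_i `|f i| * Q i j - `|f j|.
have d0 i : true -> 0 <= d i.
  move=> _; rewrite subr_ge0 {1}ff (le_trans (ler_norm_sum _ _ _)) // ler_sum //.
  by move=> i' _; rewrite normrM (gtr0_norm (Q_gt0 i' i)).
apply: (psumr_eq0P d0) => //.
rewrite sumrB exchange_big /=.
by under eq_bigr do rewrite -mulr_sumr Q_sum1 mulr1; rewrite subrr.
Qed.

Let fixed_pos f i : fixed f -> (forall j, 0 <= f j) -> f i != 0 ->
  forall j, f j != 0.
Proof.
move=> ff f0 fi j; rewrite ff gt_eqF // (bigD1 i) //= ltr_pwDl //.
  by rewrite mulr_gt0 // lt0r fi f0.
by rewrite sumr_ge0 // => i' _; rewrite mulr_ge0 // ltW.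
Qed.

Let fixed_sum0 f : fixed f -> \sum_j f j = 0 -> forall j, f j = 0.
Proof.
move=> ff f0; have fu := fixed_norm ff.
have [[i fi]|E] := pselect (exists i, `|f i| + f i != 0).
  have fD : fixed (fun j => `|f j| + f j).
    by move=> j; under eq_bigr do rewrite mulrDl; rewrite big_split -fu -ff.
  have D0 j : 0 <= `|f j| + f j by rewrite -lerBlDr sub0r -normrN ler_norm.
  apply: norm_sum0; apply: etrans f0; apply: eq_bigr => j _.
  have := fixed_pos fD D0 fi j; case: (ger0P (f j)) => // _.
  by rewrite addNr eqxx.
apply: norm_sum0.
have -> : \sum_j `|f j| = \sum_j - f j.
  apply: eq_bigr => j _; apply/eqP; rewrite -addr_eq0.
  by apply: contrapT => /negP fj; apply: E; exists j.
by rewrite sumrN f0 oppr0.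
Qed.

Lemma stationary_unique p p' :
  is_stationary Q p -> is_stationary Q p' -> p = p'.
Proof.
move=> [[_ p1] fp] [[_ q1] fq]; apply/rowP => j; apply/eqP; rewrite -subr_eq0.
apply/eqP; move: j; apply: fixed_sum0; last by rewrite sumrB p1 q1 subrr.
by move=> j; rewrite fp fq -sumrB; apply: eq_bigr => i _; rewrite mulrBl.
Qed.

Lemma stationary_exists : (0 < k)%N -> exists p, is_stationary Q p.
Proof.
move=> k0.
have [v v0 fv] : exists2 v : 'rV[R]_k, v != 0 & fixed (v 0).
  have /det0P[v v0 vQ] : \det (Q - 1%:M) == 0.
    rewrite -det_tr; apply/det0P; exists (const_mx 1).
      apply/eqP => /rowP/(_ (Ordinal k0)); rewrite !mxE => /eqP.
      by rewrite oner_eq0.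
    apply/rowP => i; rewrite !mxE.
    under eq_bigr do rewrite !mxE mul1r.
    rewrite sumrB Q_sum1 (bigD1 i) //= eqxx big1 ?addr0 ?subrr // => j ji.
    by rewrite eq_sym (negbTE ji).
  exists v => // j; move: vQ; rewrite mulmxBr mulmx1 => /eqP.
  by rewrite subr_eq0 => /eqP/rowP/(_ j); rewrite mxE => <-.
set S := \sum_j `|v 0 j|.
have S0 : 0 < S.
  rewrite lt0r sumr_ge0 // andbT; apply: contra v0 => /eqP S0.
  by apply/eqP/rowP => j; rewrite mxE (norm_sum0 S0).
exists (\row_j (`|v 0 j| / S)); split; first split.
- by move=> j; rewrite mxE divr_ge0 // ltW.
- by under eq_bigr do rewrite mxE; rewrite -mulr_suml divff // gt_eqF.
move=> j; rewrite mxE (fixed_norm fv).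
by rewrite mulr_suml; apply: eq_bigr => i _; rewrite !mxE mulrAC.
Qed.

Lemma stationaryP : (0 < k)%N -> is_stationary Q (stationary Q).
Proof. by move=> k0; apply: xgetPex (stationary_exists k0). Qed.

End Stationary.

Lemma ew_weights_gt0 (R : realType) (k : nat) (eta : R) (h : seq 'rV[R]_k) j :
  0 < ew_weights eta h 0 j.
Proof.
elim/last_ind: h => [|h l IH]; first by rewrite mxE ltr01.
by rewrite /ew_weights -cats1 foldl_cat /= mxE mulr_gt0 // expR_gt0.
Qed.

Lemma exp_weights_gt0 (R : realType) (k : nat) (eta : R) (h : seq 'rV[R]_k) j :
  0 < exp_weights eta h 0 j.
Proof.
rewrite mxE divr_gt0 ?ew_weights_gt0 // (bigD1 j) //= ltr_pwDl ?ew_weights_gt0 //.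
by rewrite sumr_ge0 // => i _; rewrite ltW // ew_weights_gt0.
Qed.

Lemma exp_weights_sum1 (R : realType) (k : nat) (eta : R) (h : seq 'rV[R]_k) :
  (0 < k)%N -> \sum_j exp_weights eta h 0 j = 1.
Proof.
move=> k0; have := exp_weights_gt0 eta h (Ordinal k0); rewrite mxE => p0.
under eq_bigr do rewrite mxE.
rewrite -mulr_suml divff //; apply: contraTneq p0 => ->.
by rewrite invr0 mulr0 ltxx.
Qed.

Lemma blum_mansour_stationary (R : realType) (k : nat) (eta : R)
    (h : seq 'rV[R]_k) : (0 < k)%N ->
  is_stationary (bm_matrix eta (bm_reports eta h)) (blum_mansour eta h).
Proof.
move=> k0; apply: stationaryP => // [i j|i]; first by rewrite mxE exp_weights_gt0.
by under eq_bigr do rewrite mxE; exact: exp_weights_sum1.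
Qed.

(* Main.v *)
(* Take two actions and put losses on action 0 only.  Copy [i] of Exponential
   Weights is then described by the odds [u i] it gives to action 0, and action
   0 is played with probability u1 (1 + u0) / (u1 (1 + u0) + 1 + u1), which is
   increasing in both odds.  With rate ln 2 the log-odds are taken in base
   two; the losses of action 0 are 0, 18, -21, where the first one is
   decreased to -2.  The decrease makes copy 0 bear a larger share of the loss
   18: the log-odds become (-11, -5) instead of (-9, -9).  Action 0 is now rare,
   so the gain 21 goes almost entirely to copy 1, which saturates; the
   probability of action 0 is then governed by copy 0, whose odds are lower
   after the decrease. *)
Require Import Defs.
From mathcomp Require Import all_boot all_order all_algebra.
From mathcomp Require Import reals sequences exp.
From mathcomp Require Import ring lra.

Set Implicit Arguments.
Unset Strict Implicit.
Unset Printing Implicit Defensive.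

Import Order.TTheory GRing.Theory Num.Theory.

Local Open Scope ring_scope.

Section TwoActions.
Variable R : realType.
Implicit Types (u v a x : R) (H : 'I_2 -> seq 'rV[R]_2).

Definition odds_prob u0 u1 : R := u1 * (1 + u0) / (u1 * (1 + u0) + (1 + u1)).

(** Cross-multiplied, the difference is a combination of [v1 - u1] and [v0 - u0] with positive
    coefficients. *)
Lemma le_odds_prob u0 u1 v0 v1 : 0 < u0 -> 0 < u1 -> u0 <= v0 -> u1 <= v1 ->
  odds_prob u0 u1 <= odds_prob v0 v1.
Proof.
move=> u0_gt0 u1_gt0 le0 le1.
have v0_gt0 := lt_le_trans u0_gt0 le0; have v1_gt0 := lt_le_trans u1_gt0 le1.
rewrite /odds_prob ler_pdivrMr; last by nra.
rewrite mulrAC ler_pdivlMr; last by nra.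
rewrite -subr_ge0.
have -> : v1 * (1 + v0) * (u1 * (1 + u0) + (1 + u1)) -
    u1 * (1 + u0) * (v1 * (1 + v0) + (1 + v1)) =
    (v1 - u1) * (1 + u0) + (v0 - u0) * (v1 * (1 + u1)) by ring.
by rewrite addr_ge0 // !mulr_ge0 ?subr_ge0 //; lra.
Qed.

(** The bound is the limit as [u1] tends to infinity, where copy 1 always plays action 0. *)
Lemma odds_prob_lt u0 u1 : 0 < u0 -> 0 < u1 ->
  odds_prob u0 u1 < (1 + u0) / (2 + u0).
Proof.
move=> u0_gt0 u1_gt0; rewrite /odds_prob ltr_pdivrMr; last by nra.
rewrite mulrAC ltr_pdivlMr; last by lra.
rewrite -subr_gt0.
have -> : (1 + u0) * (u1 * (1 + u0) + (1 + u1)) -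
  u1 * (1 + u0) * (2 + u0) = 1 + u0 by ring.
by lra.
Qed.

Definition loss0 x : 'rV[R]_2 := \row_j (if j == 0 then x else 0).

(** Action 1 never incurs a loss, so its weight stays 1 and the weight of action 0 is the odds; [a0]
    and [a1] are the base-two log-odds of the two copies. *)
Definition pow_odds H a0 a1 : Prop :=
  forall i j : 'I_2, ew_weights (ln 2) (H i) 0 j =
    if j == 0 then 2 `^ (if i == 0 then a0 else a1) else 1.

Definition pow_prob a0 a1 : R := odds_prob (2 `^ a0) (2 `^ a1).

Lemma pow_odds_stationary H a0 a1 : pow_odds H a0 a1 ->
  let p := stationary (bm_matrix (ln 2) H) in
  p 0 0 = pow_prob a0 a1 /\ p 0 1 = 1 - pow_prob a0 a1.
Proof.
move=> oH p.
have [[_]] : is_stationary (bm_matrix (ln 2) H) p.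
  apply: stationaryP => // [i j|i]; first by rewrite mxE exp_weights_gt0.
  by under eq_bigr do rewrite mxE; exact: exp_weights_sum1.
move=> + /(_ 0); rewrite !big_ord_recl !big_ord0 !addr0 !mxE.
rewrite !big_ord_recl !big_ord0 !oH /= !addr0.
have -> : lift ord0 ord0 = 1 :> 'I_2 by apply/val_inj.
rewrite /pow_prob /odds_prob.
have := powR_gt0 a0 (ltr0n R 2); have := powR_gt0 a1 (ltr0n R 2).
move: (2 `^ a0) (2 `^ a1) (p 0 0) (p 0 1) => u0 u1 x y u1_gt0 u0_gt0.
move=> xy; have {xy}-> : y = 1 - x by rewrite -xy; ring.
move=> fx; suff -> : x = u1 * (1 + u0) / (u1 * (1 + u0) + (1 + u1)) by [].
have u0N : u0 + 1 != 0 by lra.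
have u1N : u1 + 1 != 0 by lra.
have dN : u1 * (1 + u0) + (1 + u1) != 0 by nra.
apply: (mulIf dN); rewrite divfK //.
apply/eqP; rewrite -subr_eq0; apply/eqP.
(* This is the stationarity equation [fx] with its denominators cleared. *)
have -> : x * (u1 * (1 + u0) + (1 + u1)) - u1 * (1 + u0) =
    (x - (x * (u0 / (u0 + 1)) + (1 - x) * (u1 / (u1 + 1)))) *
    ((u0 + 1) * (u1 + 1)) by field; rewrite u0N u1N.
by rewrite {1}fx subrr mul0r.
Qed.

Lemma pow_odds_nil : pow_odds (bm_reports (ln 2) [::]) 0 0.
Proof. by move=> i j; rewrite /= mxE !if_same powRr0 if_same. Qed.

Lemma pow_odds_rcons (h : seq 'rV[R]_2) a0 a1 x :
  pow_odds (bm_reports (ln 2) h) a0 a1 ->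
  pow_odds (bm_reports (ln 2) (rcons h (loss0 x)))
    (a0 - pow_prob a0 a1 * x) (a1 - (1 - pow_prob a0 a1) * x).
Proof.
move=> oh i j; have [p0 p1] := pow_odds_stationary oh.
rewrite /bm_reports foldl_rcons -/(bm_reports _ h) /ew_weights foldl_rcons.
rewrite -/(ew_weights _ _) !mxE oh.
have [_|_] := eqVneq j 0; last by rewrite !mulr0 expR0 mulr1.
have exp2 a y : 2 `^ a * expR (- ln 2 * y) = 2 `^ (a - y) :> R.
  by rewrite /powR pnatr_eq0 /= -expRD; congr expR; ring.
rewrite exp2.
have [->|i_neq0] := eqVneq i 0; first by rewrite p0.
suff -> : i = 1 by rewrite p1.
by apply/val_inj; case: i i_neq0 => -[|[|//]].
Qed.

Lemma pow_odds_blum_mansour (h : seq 'rV[R]_2) a0 a1 :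
  pow_odds (bm_reports (ln 2) h) a0 a1 ->
  blum_mansour (ln 2) h 0 0 = pow_prob a0 a1.
Proof. by case/pow_odds_stationary. Qed.

Lemma pow2N n : 2 `^ (- n%:R) = (2 ^+ n)^-1 :> R.
Proof. by rewrite powRN powR_mulrn ?ler0n. Qed.

Lemma le_pow_prob a0 a1 b0 b1 : a0 <= b0 -> a1 <= b1 ->
  pow_prob a0 a1 <= pow_prob b0 b1.
Proof.
by move=> ab0 ab1; apply: le_odds_prob; rewrite ?powR_gt0 ?ler_powR ?ler1n.
Qed.

Lemma pow_prob00 : pow_prob 0 0 = 1 / 2.
Proof. by rewrite /pow_prob /odds_prob !powRr0; field. Qed.

Lemma pow_prob11 : pow_prob 1 1 = 2 / 3.
Proof. by rewrite /pow_prob /odds_prob !powRr1 ?ler0n //; field. Qed.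

Lemma blum_mansour_three x0 x1 x2 :
  let p0 := pow_prob 0 0 in
  let a0 := 0 - p0 * x0 in let a1 := 0 - (1 - p0) * x0 in
  let p1 := pow_prob a0 a1 in
  let b0 := a0 - p1 * x1 in let b1 := a1 - (1 - p1) * x1 in
  let p2 := pow_prob b0 b1 in
  blum_mansour (ln 2) [:: loss0 x0; loss0 x1; loss0 x2] 0 0 =
    pow_prob (b0 - p2 * x2) (b1 - (1 - p2) * x2).
Proof.
move=> p0 a0 a1 p1 b0 b1 p2; apply: pow_odds_blum_mansour.
apply: (@pow_odds_rcons [:: loss0 x0; loss0 x1]).
apply: (@pow_odds_rcons [:: loss0 x0]).
exact: (@pow_odds_rcons [::] _ _ _ pow_odds_nil).
Qed.

Lemma blum_mansour_original_ge : pow_prob (- 9) 11 <=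
  blum_mansour (ln 2) [:: loss0 0; loss0 18; loss0 (- 21)] 0 0.
Proof.
rewrite blum_mansour_three pow_prob00.
have -> : 0 - 1 / 2 * 0 = 0 :> R by ring.
have -> : 0 - (1 - 1 / 2) * 0 = 0 :> R by ring.
rewrite pow_prob00.
have -> : 0 - 1 / 2 * 18 = - 9 :> R by field.
have -> : 0 - (1 - 1 / 2) * 18 = - 9 :> R by field.
have -> : pow_prob (- 9) (- 9) = 1 / 513.
  by rewrite /pow_prob /odds_prob !pow2N; field.
(* The exact log-odds, [-9 + 21/513] and [-9 + 21 * 512/513], are rounded down to integers so that
   the powers of 2 become rational. *)
by apply: le_pow_prob; lra.
Qed.

Lemma blum_mansour_decreased_le :
  blum_mansour (ln 2) [:: loss0 (- 2); loss0 18; loss0 (- 21)] 0 0 <=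
  pow_prob (- 10) 16.
Proof.
rewrite blum_mansour_three pow_prob00.
have -> : 0 - 1 / 2 * - 2 = 1 :> R by field.
have -> : 0 - (1 - 1 / 2) * - 2 = 1 :> R by field.
rewrite pow_prob11.
(* Copy 0 now bears 12 of the loss 18 and copy 1 only 6. *)
have -> : 1 - 2 / 3 * 18 = - 11 :> R by field.
have -> : 1 - (1 - 2 / 3) * 18 = - 5 :> R by field.
have -> : pow_prob (- 11) (- 5) = 683 / 23211.
  by rewrite /pow_prob /odds_prob !pow2N; field.
(* Here the log-odds, about -10.4 and 15.4, are rounded up. *)
by apply: le_pow_prob; lra.
Qed.

Lemma lt_pow_prob_bounds : pow_prob (- 10) 16 < pow_prob (- 9) 11.
Proof.
apply: (lt_trans (odds_prob_lt _ _)); rewrite ?powR_gt0 //.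
have -> : pow_prob (- 9) 11 = 2052 / 4101.
  by rewrite /pow_prob /odds_prob pow2N powR_mulrn ?ler0n //; field.
have -> : (1 + 2 `^ (- 10)) / (2 + 2 `^ (- 10)) = 1025 / 2049 :> R.
  by rewrite pow2N; field.
by lra.
Qed.

End TwoActions.

Theorem lemma14 (R : realType) :
  exists (k : nat) (eta : R),
    [/\ 0 < eta,
        ~ monotone (@blum_mansour R k eta) &
        exists (T : nat) (l l' : T.-tuple 'rV[R]_k)
               (s : 'I_T) (a : 'I_k) (t : 'I_T),
          [/\ decreased_at s a l l',
              (s < t)%N &
              blum_mansour eta (take t l') 0 a
                < blum_mansour eta (take t l) 0 a]].
Proof.
pose l0 x := @loss0 R x.
(* The fourth loss is never observed: it only makes round 3, counted from 0, lie within the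
   horizon. *)
pose l := [tuple l0 0; l0 18; l0 (- 21); l0 0].
pose l' := [tuple l0 (- 2); l0 18; l0 (- 21); l0 0].
have dec : decreased_at (0 : 'I_4) (0 : 'I_2) l l'.
  split; first by rewrite !(tnth_nth 0) !mxE /=; lra.
  move=> r b; rewrite !(tnth_nth 0).
  case: r => -[|[|[|[|//]]]] ltr //=; rewrite !mxE.
  by have [-> /eqP[]|] := eqVneq b 0; first by congr pair; apply/val_inj.
have lt_prob : blum_mansour (ln 2) (take 3 l') 0 0 <
    blum_mansour (ln 2) (take 3 l) 0 0.
  apply: le_lt_trans (blum_mansour_decreased_le R) _.
  exact: lt_le_trans (lt_pow_prob_bounds R) (blum_mansour_original_ge R).
exists 2, (ln 2); split; first by rewrite ln_gt0 // ltr1n.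
  move=> mono; have := mono _ _ _ _ _ dec (Ordinal (isT : 3 < 4)%N) isT.
  by rewrite leNgt lt_prob.
by exists 4, l, l', 0, 0, (Ordinal (isT : 3 < 4)%N).
Qed.
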